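(* Let $w_1,w_2$ be any odd positive integers, let $n\ge 0$ be an integer and let $y_1\in\mathbb{Z}_p$. Then the following eight expressions are all equal: \begin{align*} &\sum_{k=0}^{n}\binom{n}{k}E_{k,q^{w_2}}(w_1y_1)\,T_{n-k,q^{w_1}}(w_2-1)\,w_1^{n-k}w_2^{k}\\ =&\sum_{k=0}^{n}\binom{n}{k}E_{k,q^{w_1}}(w_2y_1)\,T_{n-k,q^{w_2}}(w_1-1)\,w_2^{n-k}w_1^{k}\\ =&\,w_1^{n}\sum_{i=0}^{w_1-1}(-1)^{i}q^{w_2 i}E_{n,q^{w_1}}\Big(w_2y_1+\frac{w_2}{w_1}i\Big)\\ =&\,w_2^{n}\sum_{i=0}^{w_2-1}(-1)^{i}q^{w_1 i}E_{n,q^{w_2}}\Big(w_1y_1+\frac{w_1}{w_2}i\Big)\\ =&\sum_{k+l+m=n}\binom{n}{k,l,m}E_{k,q^{w_1w_2}}(y_1)\,T_{l,q^{w_2}}(w_1-1)\,T_{m,q^{w_1}}(w_2-1)\,w_1^{k+m}w_2^{k+l}\\ =&\,w_1^{n}\sum_{k=0}^{n}\binom{n}{k}T_{n-k,q^{w_1}}(w_2-1)\,w_2^{k}\sum_{i=0}^{w_1-1}(-1)^{i}q^{w_2 i}E_{k,q^{w_1w_2}}\Big(y_1+\frac{i}{w_1}\Big)\\ =&\,w_2^{n}\sum_{k=0}^{n}\binom{n}{k}T_{n-k,q^{w_2}}(w_1-1)\,w_1^{k}\sum_{i=0}^{w_2-1}(-1)^{i}q^{w_1 i}E_{k,q^{w_1w_2}}\Big(y_1+\frac{i}{w_2}\Big)\\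 =&\,(w_1w_2)^{n}\sum_{i=0}^{w_1-1}\sum_{j=0}^{w_2-1}(-1)^{i+j}q^{w_2i+w_1j}E_{n,q^{w_1w_2}}\Big(y_1+\frac{i}{w_1}+\frac{j}{w_2}\Big). \end{align*}
   Context: Let $p$ be a fixed odd prime, $\mathbb{C}_p$ the completion of an algebraic closure of $\mathbb{Q}_p$ with absolute value normalized by $|p|_p=1/p$, and let $q\in\mathbb{C}_p$ be fixed with $|q-1|_p<p^{-1/(p-1)}$. For $r\in\mathbb{C}_p$ with $|r-1|_p<p^{-1/(p-1)}$ (in particular for $r=q^w$, $w$ a positive integer), the $r$-Euler polynomials $E_{n,r}(x)$ ($n\ge 0$) are the polynomials in $x$ defined by the generating function $$\frac{2}{re^{t}+1}e^{xt}=\sum_{n=0}^{\infty}E_{n,r}(x)\frac{t^n}{n!}.$$ For integers $k,N\ge 0$, the $r$-analogue of the alternating power sum is $T_{k,r}(N)=\sum_{i=0}^{N}(-1)^i i^k r^i$, with the convention $0^0=1$. Sums over $k+l+m=n$ run over all nonnegative integers $k,l,m$ with $k+l+m=n$, and $\binom{n}{k,l,m}=\frac{n!}{k!\,l!\,m!}$. *)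

(* Defs.v *)
From HB Require Import structures.
From mathcomp Require Import all_boot all_order all_algebra.
From mathcomp Require Import reals exp.

Set Implicit Arguments.
Unset Strict Implicit.
Unset Printing Implicit Defensive.

Import Order.TTheory GRing.Theory Num.Theory.
Local Open Scope ring_scope.

Record is_absval (R : realType) (K : fieldType) (v : K -> R) : Prop :=
  IsAbsval {
    absval_ge0 : forall x, 0 <= v x;
    absval_eq0 : forall x, v x = 0 <-> x = 0;
    absvalM : forall x y, v (x * y) = v x * v y;
    absval_triangle : forall x y, v (x + y) <= v x + v y
  }.

Definition absval_cauchy (R : realType) (K : fieldType) (v : K -> R)
    (u : nat -> K) : Prop :=
  forall e : R, 0 < e ->
    exists N : nat, forall m n : nat, (N <= m)%N -> (N <= n)%N ->
      v (u m - u n) < e.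

Definition absval_cvg (R : realType) (K : fieldType) (v : K -> R)
    (u : nat -> K) (l : K) : Prop :=
  forall e : R, 0 < e ->
    exists N : nat, forall n : nat, (N <= n)%N -> v (u n - l) < e.

Record is_completion (R : realType) (K L : fieldType) (vK : K -> R)
    (vL : L -> R) (f : {rmorphism K -> L}) : Prop :=
  IsCompletion {
    completion_absval : is_absval vL;
    completion_isometry : forall x, vL (f x) = vK x;
    completion_dense : forall (y : L) (e : R), 0 < e ->
      exists x : K, vL (y - f x) < e;
    completion_complete : forall u : nat -> L, absval_cauchy vL u ->
      exists l : L, absval_cvg vL u l
  }.

Record is_algebraic_closure (K L : fieldType) (f : {rmorphism K -> L}) : Prop :=
  IsAlgebraicClosure {
    algclosure_algebraic : forall x : L, algebraicOver f x;
    algclosure_closed : GRing.closed_field_axiom L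
  }.

Definition padic_abs (R : realType) (p : nat) (x : rat) : R :=
  if x == 0 then 0
  else p%:R ^ ((logn p `|denq x|)%:Z - (logn p `|numq x|)%:Z).

(* These data determine the tower Q -> Qp -> Qpbar -> Cp up to isometric
   isomorphism; the normalization |p| = 1/p is that of padic_abs. *)
Record padicComplex (R : realType) (p : nat) := PadicComplex {
  Qp : fieldType;
  absQp : Qp -> R;
  rat_Qp : {rmorphism rat -> Qp};
  QpP : is_completion (@padic_abs R p) absQp rat_Qp;
  Qpbar : fieldType;
  absQpbar : Qpbar -> R;
  Qp_Qpbar : {rmorphism Qp -> Qpbar};
  QpbarP : is_algebraic_closure Qp_Qpbar;
  absQpbarP : is_absval absQpbar;
  absQpbar_ext : forall x : Qp, absQpbar (Qp_Qpbar x) = absQp x;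
  Cp :> fieldType;
  absCp : Cp -> R;
  Qpbar_Cp : {rmorphism Qpbar -> Cp};
  CpP : is_completion absQpbar absCp Qpbar_Cp
}.

Definition padic_integer (R : realType) (p : nat) (C : padicComplex R p)
    (y : Qp C) : Prop :=
  absQp y <= 1.

Definition Qp_Cp (R : realType) (p : nat) (C : padicComplex R p) (y : Qp C) :
    Cp C :=
  Qpbar_Cp C (Qp_Qpbar C y).

(* Formal power series in t: [a : nat -> A] stands for \sum_n a n * t^n. *)
Section FormalPowerSeries.
Variable A : comUnitRingType.
Implicit Types a b c : nat -> A.

Definition fps_const (x : A) : nat -> A := fun n => if n == 0%N then x else 0.

Definition fps_add a b : nat -> A := fun n => a n + b n.

Definition fps_mul a b : nat -> A := fun n => \sum_(i < n.+1) a i * b (n - i)%N.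

Fixpoint fps_inv_seq a (n : nat) : seq A :=
  if n is m.+1 then
    let s := fps_inv_seq a m in
    rcons s ((a 0%N)^-1 *
             ((m == 0%N)%:R - \sum_(i < m) s`_i * a (m - i)%N))
  else [::].

(* Meaningful when the constant term [a 0] is a unit, see fps_mulV. *)
Definition fps_inv a : nat -> A := fun n => (fps_inv_seq a n.+1)`_n.

Lemma size_fps_inv_seq a n : size (fps_inv_seq a n) = n.
Proof. by elim: n => //= n IHn; rewrite size_rcons IHn. Qed.

Lemma nth_fps_inv_seq a n i : (i < n)%N -> (fps_inv_seq a n)`_i = fps_inv a i.
Proof.
elim: n => // n IHn; rewrite ltnS leq_eqVlt => /orP[/eqP -> //|lt_in].
by rewrite /= nth_rcons size_fps_inv_seq lt_in IHn.
Qed.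

Lemma fps_invE a n :
  fps_inv a n =
  (a 0%N)^-1 * ((n == 0%N)%:R - \sum_(i < n) fps_inv a i * a (n - i)%N).
Proof.
rewrite {1}/fps_inv /= nth_rcons size_fps_inv_seq ltnn eqxx.
congr (_ * (_ - _)); apply: eq_bigr => i _.
by rewrite nth_fps_inv_seq.
Qed.

Lemma fps_mulV a : a 0%N \is a GRing.unit ->
  fps_mul (fps_inv a) a =1 fps_const 1.
Proof.
move=> a0U n; rewrite /fps_mul big_ord_recr /= subnn [fps_inv a n]fps_invE.
rewrite mulrAC mulVr // mul1r addrC subrK /fps_const.
by case: (n == 0%N).
Qed.

Lemma fps_mul_polyE a b n N : (n < N)%N ->
  fps_mul a b n = ((\poly_(i < N) a i) * (\poly_(i < N) b i))`_n.
Proof.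
move=> ltnN; rewrite coefM; apply: eq_bigr => i _; rewrite !coef_poly.
have lt_iN : (i < N)%N by apply: leq_trans ltnN; rewrite ltn_ord.
by rewrite lt_iN (leq_ltn_trans (leq_subr _ _) ltnN).
Qed.

Lemma fps_mulC a b : fps_mul a b =1 fps_mul b a.
Proof. by move=> n; rewrite !(@fps_mul_polyE _ _ n n.+1) // mulrC. Qed.

Lemma fps_mulA a b c :
  fps_mul a (fps_mul b c) =1 fps_mul (fps_mul a b) c.
Proof.
move=> n; set T := fun d : nat -> A => \poly_(i < n.+1) d i.
have TE d i : (i <= n)%N -> d i = (T d)`_i by rewrite coef_poly ltnS => ->.
transitivity ((T a * (T b * T c))`_n); last rewrite mulrA.
  rewrite coefM; apply: eq_bigr => i _.
  have le_in : (i <= n)%N by rewrite -ltnS.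
  by rewrite -TE // (@fps_mul_polyE _ _ _ n.+1) // ltnS leq_subr.
rewrite coefM; apply: eq_bigr => i _.
rewrite (@fps_mul_polyE _ _ i n.+1) //.
by congr (_ * _); rewrite -TE // leq_subr.
Qed.

Lemma fps_mul1 a : fps_mul (fps_const 1) a =1 a.
Proof.
move=> n; rewrite /fps_mul big_ord_recl /fps_const /= mul1r subn0.
by rewrite big1 ?addr0 // => i _; rewrite mul0r.
Qed.

Lemma eq_fps_mul a a' b b' : a =1 a' -> b =1 b' ->
  fps_mul a b =1 fps_mul a' b'.
Proof. by move=> ea eb n; apply: eq_bigr => i _; rewrite ea eb. Qed.

End FormalPowerSeries.

Section EulerPolynomials.
Variable K : fieldType.

(* The series e^{at}. *)
Definition fps_exp (a : {poly K}) : nat -> {poly K} :=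
  fun n => n`!%:R^-1 *: a ^+ n.

(* The series r e^t + 1. *)
Definition euler_den (r : K) : nat -> {poly K} :=
  fps_add (fps_mul (fps_const r%:P) (fps_exp 1)) (fps_const 1).

(* n! times the coefficient of t^n in 2 / (r e^t + 1) * e^{xt}, with the
   indeterminate x of the polynomial written 'X. *)
Definition euler_poly (n : nat) (r : K) : {poly K} :=
  n`!%:R *:
    fps_mul (fps_mul (fps_const 2) (fps_inv (euler_den r))) (fps_exp 'X) n.

Lemma euler_poly_genfun (r : K) :
  (forall n : nat, n.+1%:R != 0 :> K) -> r + 1 != 0 ->
  fps_mul (euler_den r) (fun n => n`!%:R^-1 *: euler_poly n r)
  =1 fps_mul (fps_const 2) (fps_exp 'X).
Proof.
move=> char0 r1 n.
set D := euler_den r; set c2 := fps_const 2; set X := fps_exp 'X.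
have DU : D 0%N \is a GRing.unit.
  rewrite /D /euler_den /fps_add /fps_mul big_ord1 /fps_const /fps_exp /=.
  rewrite fact0 invr1 scale1r expr0 mulr1 -[X in _ + X]/(1%:P) -polyCD.
  by rewrite poly_unitE size_polyC r1 coefC /= unitfE.
rewrite (@eq_fps_mul _ D D _ (fps_mul (fps_mul c2 (fps_inv D)) X)) //; last first.
  move=> m; rewrite /euler_poly scalerA mulVf ?scale1r //.
  by rewrite -(prednK (fact_gt0 m)) char0.
rewrite fps_mulA; apply: eq_fps_mul => // {}n.
rewrite fps_mulC -fps_mulA.
rewrite (@eq_fps_mul _ c2 c2 _ (fps_const 1)) //; last exact: fps_mulV.
by rewrite fps_mulC fps_mul1.
Qed.

Definition euler (n : nat) (r x : K) : K := (euler_poly n r).[x].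

Definition alt_power_sum (k : nat) (r : K) (N : nat) : K :=
  \sum_(i < N.+1) (-1) ^+ i * i%:R ^+ k * r ^+ i.

Definition trinomial (n k l m : nat) : K :=
  n`!%:R / (k`! * l`! * m`!)%N%:R.

End EulerPolynomials.

(* Main.v *)
Require Import Defs.
From HB Require Import structures.
From mathcomp Require Import all_boot all_order all_algebra.
From mathcomp Require Import reals exp.
From mathcomp Require Import ring lra zify.

Set Implicit Arguments.
Unset Strict Implicit.
Unset Printing Implicit Defensive.

Import Order.TTheory GRing.Theory Num.Theory.
Local Open Scope ring_scope.

(* Write B_z a (n) = \sum_k C(n,k) a_k z^(n-k); these binomial transforms satisfy
   B_z B_x = B_(x+z). For r != -1 the values a_n = E_(n,r)(x) are the only
   solution of r B_1 a (n) + a_n = 2 x^n. Uniqueness yields the addition formula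
   E_(n,r)(x + z) = B_z (E_(.,r)(x)) (n) and, by telescoping, the distribution
   relation w^n \sum_(i < w) (-1)^i r^i E_(n,r^w)(x + i/w) = E_(n,r)(w x) for odd
   w. These two turn the fourth, fifth, sixth and eighth expressions into the
   first; the eighth one is symmetric in w1 and w2, which gives the others.
   Finally q^w != -1 because |q^w - 1| <= |q - 1| < 1 = |2|. *)

(** * Absolute values bounded on the naturals *)

Section AbsoluteValue.
Variables (R : realType) (K : fieldType) (v : K -> R).
Hypothesis vP : is_absval v.

Let v_ge0 x : 0 <= v x. Proof. exact: absval_ge0. Qed.

Lemma absval1 : v 1 = 1.
Proof.
have v1 : v 1 != 0 by apply/eqP => /(absval_eq0 vP)/eqP; rewrite oner_eq0.
by apply: (mulfI v1); rewrite -(absvalM vP) !mulr1.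
Qed.

Lemma absvalN x : v (- x) = v x.
Proof.
suff vN1 : v (-1) = 1 by rewrite -mulN1r (absvalM vP) vN1 mul1r.
have /eqP := absvalM vP (-1) (-1).
rewrite mulrNN mulr1 absval1 eq_sym -expr2 sqrf_eq1 => /orP[/eqP //|/eqP vN].
by have := absval_ge0 vP (-1); rewrite vN; lra.
Qed.

Lemma absvalX x n : v (x ^+ n) = v x ^+ n.
Proof.
by elim: n => [|n IHn]; rewrite ?absval1 // !exprS (absvalM vP) IHn.
Qed.

Lemma absval_sum n (F : 'I_n -> K) : v (\sum_i F i) <= \sum_i v (F i).
Proof.
elim/big_ind2: _ => [|x a y b le_xa le_yb|//].
  by rewrite (proj2 (absval_eq0 vP 0)).
exact: le_trans (absval_triangle vP _ _) (lerD le_xa le_yb).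
Qed.

(** If a = 1 + d with d > 0, the square of Bernoulli's bound makes the even powers of a grow
    quadratically. *)
Lemma linear_growth_le1 (a : R) :
  0 <= a -> (forall n, a ^+ n <= n.+1%:R) -> a <= 1.
Proof.
move=> a_ge0 le_a; rewrite leNgt; apply/negP => a_gt1.
pose d := a - 1; have d_gt0 : 0 < d by rewrite /d; lra.
have bernoulli n : 1 + n%:R * d <= a ^+ n.
  elim: n => [|n IHn]; first by rewrite mul0r addr0 expr0.
  rewrite exprS -natr1; have := ler_wpM2l a_ge0 IHn.
  have : 0 <= n%:R * d * d by rewrite !mulr_ge0 // ltW.
  rewrite /d; nra.
(* This n gives 2n < (n d)^2, so that (1 + n d)^2 exceeds the bound 2n + 1 assumed for
   [a ^+ (n * 2)]. *)
have [n lt_n] : exists n : nat, 2 / d ^+ 2 < n%:R.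
  exists (Num.bound (2 / d ^+ 2)); apply: archi_boundP.
  by rewrite divr_ge0 ?exprn_ge0 // ltW.
have {}lt_n : 2 < n%:R * d ^+ 2 by rewrite -ltr_pdivrMr ?exprn_gt0.
have := le_a (n * 2)%N; rewrite exprM -natr1 natrM.
have n_ge0 : 0 <= n%:R :> R by [].
have le1 : 1 + n%:R * d <= a ^+ n := bernoulli n.
have : (1 + n%:R * d) ^+ 2 <= (a ^+ n) ^+ 2.
  by rewrite ler_sqr ?nnegrE ?exprn_ge0 // addr_ge0 // mulr_ge0 // ltW.
have : n%:R * 2 <= n%:R * (n%:R * d ^+ 2) by rewrite ler_wpM2l // ltW.
have : 0 < n%:R * d.
  rewrite mulr_gt0 // lt_neqAle n_ge0 andbT.
  by apply: contraTneq lt_n => <-; rewrite mul0r -leNgt.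
rewrite !expr2; nra.
Qed.

Hypothesis v_nat : forall n : nat, v n%:R <= 1.

(* An absolute value bounded on the naturals is ultrametric: the binomial
   expansion gives [v (x + y) ^+ n <= (n + 1) M ^+ n]. *)
Lemma absval_ultra M x y : v x <= M -> v y <= M -> v (x + y) <= M.
Proof.
move=> le_xM le_yM; have M_ge0 : 0 <= M := le_trans (absval_ge0 vP x) le_xM.
have bound n : v (x + y) ^+ n <= n.+1%:R * M ^+ n.
  rewrite -absvalX exprDn; apply: le_trans (absval_sum _) _.
  have -> : n.+1%:R * M ^+ n = \sum_(i < n.+1) M ^+ n.
    by rewrite sumr_const card_ord mulr_natl.
  apply: ler_sum => i _; rewrite -mulr_natl !(absvalM vP) !absvalX.
  have le_in : (i <= n)%N by rewrite -ltnS.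
  rewrite -[leRHS]mul1r ler_pM ?v_ge0 ?mulr_ge0 ?exprn_ge0 ?v_ge0 //.
  rewrite -[in leRHS](subnK le_in) exprD.
  by rewrite ler_pM ?exprn_ge0 ?v_ge0 // lerXn2r ?nnegrE ?v_ge0.
have [M0|M_neq0] := eqVneq M 0.
  by have := bound 1%N; rewrite !expr1 M0 mulr0.
have M_gt0 : 0 < M by rewrite lt_neqAle eq_sym M_neq0.
rewrite -[leRHS]mul1r -ler_pdivrMr //.
apply: linear_growth_le1 => [|n]; first by rewrite divr_ge0 ?v_ge0.
by rewrite expr_div_n ler_pdivrMr ?exprn_gt0.
Qed.

(** Ultrametric induction on n: [v q <= 1], so multiplying the previous difference by q does not
    enlarge it. *)
Lemma absval_expr_sub1 q n : v (q - 1) <= 1 -> v (q ^+ n - 1) <= v (q - 1).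
Proof.
move=> q_near1; have vq : v q <= 1.
  by rewrite -[q](subrK 1); apply: absval_ultra; rewrite ?absval1.
elim: n => [|n IHn].
  by rewrite expr0 subrr (proj2 (absval_eq0 vP 0)) ?v_ge0.
have -> : q ^+ n.+1 - 1 = q * (q ^+ n - 1) + (q - 1) by rewrite exprS; ring.
apply: absval_ultra => //; rewrite (absvalM vP) -[leRHS]mul1r.
by rewrite ler_pM ?v_ge0.
Qed.

Lemma expr_add1_neq0 q n : v 2 = 1 -> v (q - 1) < 1 -> q ^+ n + 1 != 0.
Proof.
move=> v2 q_near1; apply/eqP => q0.
have := absval_expr_sub1 n (ltW q_near1).
rewrite -[q ^+ n](addrK 1) q0 (_ : 0 - 1 - 1 = - 2); last by ring.
by rewrite absvalN v2 leNgt q_near1.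
Qed.

End AbsoluteValue.

(** * Characteristic and absolute values of naturals in the p-adic complex field *)

Section PadicComplex.
Variables (R : realType) (p : nat) (C : padicComplex R p).

Lemma absCp_nat n : absCp (n%:R : Cp C) = padic_abs R p n%:R.
Proof.
rewrite -(rmorph_nat (Qpbar_Cp C)) (completion_isometry (CpP C)).
rewrite -(rmorph_nat (Qp_Qpbar C)) absQpbar_ext -(rmorph_nat (rat_Qp C)).
by rewrite (completion_isometry (QpP C)).
Qed.

Lemma padic_abs_nat n :
  padic_abs R p n%:R = if n == 0%N then 0 else p%:R ^- logn p n.
Proof.
rewrite /padic_abs pnatr_eq0 (pmulrn (1 : rat) n) numq_int denq_int logn1 sub0r.
by rewrite exprnN.
Qed.

Hypothesis p_prime : prime p.

Lemma absCp_nat_le1 n : absCp (n%:R : Cp C) <= 1.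
Proof.
rewrite absCp_nat padic_abs_nat; case: ifP => // _.
by rewrite invf_le1 ?exprn_gt0 ?exprn_ege1 ?ltr0n ?ler1n ?prime_gt0.
Qed.

Lemma absCp_nat_coprime n : (0 < n)%N -> ~~ (p %| n)%N ->
  absCp (n%:R : Cp C) = 1.
Proof.
move=> n_gt0 p'n; rewrite absCp_nat padic_abs_nat gtn_eqF //.
by rewrite lognE (negPf p'n) !andbF expr0 invr1.
Qed.

Lemma Cp_char0 n : n.+1%:R != 0 :> Cp C.
Proof.
rewrite -(rmorph_nat (Qpbar_Cp C)) -(rmorph_nat (Qp_Qpbar C)).
by rewrite -(rmorph_nat (rat_Qp C)) !fmorph_eq0 pnatr_eq0.
Qed.

Lemma Cp_expr_add1_neq0 (q : Cp C) n : odd p ->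
  absCp (q - 1) < p%:R `^ (- (p%:R - 1)^-1) -> q ^+ n + 1 != 0.
Proof.
move=> p_odd hq.
apply: (expr_add1_neq0 (completion_absval (CpP C)) absCp_nat_le1).
  (* Since p is odd it does not divide 2, whence |2| = 1. *)
  by apply: absCp_nat_coprime => //; rewrite dvdn_prime2 //; case: eqP p_odd => // ->.
(* The exponent -1/(p-1) is nonpositive, so the given radius is at most p^0 = 1. *)
apply: lt_le_trans hq _; rewrite -[leRHS](powRr0 p%:R).
rewrite ler_powR ?ler1n ?prime_gt0 // oppr_le0 invr_ge0 subr_ge0 ler1n.
exact: prime_gt0.
Qed.

End PadicComplex.

(** * Binomial transforms of sequences *)

Section BinomialTransform.
Variable A : comNzRingType.
Implicit Types (a b : nat -> A) (x z : A).

(** On exponential generating functions this is multiplication by e^{zt}. *)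
Definition binom_transform z a n : A :=
  \sum_(k < n.+1) 'C(n, k)%:R * a k * z ^+ (n - k).

Lemma eq_binom_transform z a b :
  a =1 b -> binom_transform z a =1 binom_transform z b.
Proof. by move=> eab n; apply: eq_bigr => k _; rewrite eab. Qed.

Lemma binom_transformD z a b n :
  binom_transform z (fun k => a k + b k) n =
  binom_transform z a n + binom_transform z b n.
Proof.
by rewrite -big_split; apply: eq_bigr => k _; rewrite mulrDr mulrDl.
Qed.

Lemma binom_transformZ z c a n :
  binom_transform z (fun k => c * a k) n = c * binom_transform z a n.
Proof. by rewrite mulr_sumr; apply: eq_bigr => k _; ring. Qed.

Lemma binom_transform_sum (I : finType) (P : pred I) z (F : I -> nat -> A) n :
  binom_transform z (fun k => \sum_(i | P i) F i k) n =
  \sum_(i | P i) binom_transform z (F i) n.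
Proof.
rewrite exchange_big; apply: eq_bigr => k _.
by rewrite mulr_sumr mulr_suml.
Qed.

Lemma binom_transform_expr z x n :
  binom_transform z (fun k => x ^+ k) n = (x + z) ^+ n.
Proof.
rewrite addrC exprDn; apply: eq_bigr => k _; rewrite -mulr_natl; ring.
Qed.

(* Umbrally, [binom_transform z a n] is [('X + z) ^+ n] with ['X^k] replaced
   by [a k]. *)
Let umbral a (p : {poly A}) N : A := \sum_(i < N) p`_i * a i.

(** The truncation N is free so that powers of different degrees can be read off over one common
    range of coefficients. *)
Lemma binom_transform_umbral z a n N : (n < N)%N ->
  binom_transform z a n = umbral a (('X + z%:P) ^+ n) N.
Proof.
move=> ltnN; rewrite /umbral /binom_transform (big_ord_widen _ (fun k =>
  'C(n, k)%:R * a k * z ^+ (n - k)) ltnN) big_mkcond; apply: eq_bigr => i _.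
rewrite addrC exprDn coef_sum.
case: ltnP => [lt_in | le_ni].
  rewrite (bigD1 (Ordinal lt_in)) //= big1 ?addr0.
    by rewrite coefMn -polyC_exp coefCM coefXn eqxx mulr1 !mulrnAl mul1r mulrC.
  move=> k neq_ki; rewrite coefMn -polyC_exp coefCM coefXn.
  by rewrite eq_sym (negPf (_ : (k : nat) != i)) ?mulr0 ?mul0rn.
rewrite big1 ?mul0r // => k _; rewrite coefMn -polyC_exp coefCM coefXn.
by rewrite gtn_eqF ?mulr0 ?mul0rn // (leq_trans _ le_ni).
Qed.

(** Umbral form of e^{xt} e^{zt} = e^{(x+z)t}: expand ('X + x + z)^n in powers of 'X + x. *)
Lemma binom_transform_comp z x a n :
  binom_transform z (binom_transform x a) n = binom_transform (x + z) a n.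
Proof.
rewrite [RHS](@binom_transform_umbral _ _ n n.+1) // polyCD addrA /umbral.
rewrite [_ + z%:P]addrC exprDn.
under [RHS]eq_bigr => i _ do rewrite coef_sum mulr_suml.
rewrite exchange_big; apply: eq_bigr => k _.
rewrite (@binom_transform_umbral _ _ k n.+1) // mulr_sumr mulr_suml.
apply: eq_bigr => i _; rewrite coefMn -polyC_exp coefCM !mulrnAl mul1r.
by rewrite mulrC mulrA.
Qed.

End BinomialTransform.

(** Terms are grouped by s = k + l, which forces m = n - s; a trinomial sum thus becomes two nested
    binomial ones. *)
Lemma big_ord_trinomial (A : nmodType) n (G : nat -> nat -> nat -> A) :
  \sum_(k < n.+1) \sum_(l < n.+1) \sum_(m < n.+1 | (k + l + m)%N == n) G k l m
  = \sum_(s < n.+1) \sum_(k < s.+1) G k (s - k)%N (n - s)%N.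
Proof.
under eq_bigr => k _ do under eq_bigr => l _ do rewrite big_mkcond.
under eq_bigr => k _ do rewrite exchange_big.
rewrite exchange_big (reindex_inj rev_ord_inj); apply: eq_bigr => s _ /=.
have le_sn : (s <= n)%N by rewrite -ltnS.
rewrite (big_ord_widen n.+1 (fun k => G k (s - k)%N (n - s)%N)) ?ltnS //.
rewrite [RHS]big_mkcond; apply: eq_bigr => k _; rewrite subSS -big_mkcond /=.
(* The constraint leaves the single value l = s - k when k <= s, and no l otherwise. *)
case: ltnP => [le_ks | lt_sk].
  rewrite (big_pred1 (inord (s - k))) ?inordK ?ltnS; [by []| lia |].
  by move=> l /=; rewrite -val_eqE /= inordK ?ltnS; lia.
by rewrite big_pred0 // => l; lia.
Qed.

(** * Recurrence, addition formula and distribution relation for Euler values *)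

Section EulerValues.
Variable K : fieldType.
Hypothesis char0 : forall n : nat, n.+1%:R != 0 :> K.
Implicit Types (r x z : K) (n w : nat).

Lemma fact_neq0 n : n`!%:R != 0 :> K.
Proof. by rewrite -(prednK (fact_gt0 n)) char0. Qed.

Lemma bin_factE n k : (k <= n)%N ->
  'C(n, k)%:R = n`!%:R / (k`!%:R * (n - k)`!%:R) :> K.
Proof.
move=> le_kn; rewrite -(bin_fact le_kn) !natrM mulfK //.
by rewrite mulf_neq0 ?fact_neq0.
Qed.

Lemma horner_euler_den r x n :
  (euler_den r n).[x] = r / n`!%:R + (n == 0%N)%:R.
Proof.
rewrite /euler_den /fps_add hornerD {1}/fps_mul big_ord_recl big1 ?addr0.
  rewrite /fps_const /fps_exp /= subn0 hornerCM hornerZ expr1n hornerC mulr1.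
  by case: (n == 0%N); rewrite ?hornerC ?horner0.
by move=> i _; rewrite mul0r.
Qed.

(** This is n! times the coefficient of t^n in (r e^t + 1) F(t) = 2 e^{xt}, with F the generating
    function. *)
Lemma euler_rec r x n : r + 1 != 0 ->
  r * binom_transform 1 (fun k => euler k r x) n + euler n r x = 2 * x ^+ n.
Proof.
move=> r1; have := euler_poly_genfun char0 r1 n.
rewrite fps_mulC => /(congr1 (fun P : {poly K} => n`!%:R * P.[x])).
rewrite [in RHS]/fps_mul big_ord_recl big1 ?addr0; last first.
  by move=> i _; rewrite mul0r.
rewrite /fps_exp /fps_const /= subn0 hornerM -polyC_natr hornerC hornerZ hornerXn.
rewrite mulrCA mulVKf ?fact_neq0 // => <-.
rewrite /fps_mul horner_sum mulr_sumr /binom_transform mulr_sumr.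
(* Only the top term k = n meets the constant coefficient r + 1 of the denominator; its summand 1
   yields the isolated [euler n r x]. *)
rewrite big_ord_recr [RHS]big_ord_recr /= -addrA; congr (_ + _); last first.
  rewrite hornerM hornerZ horner_euler_den subnn fact0 eqxx binn /euler /=.
  by field; rewrite oner_neq0 fact_neq0.
apply: eq_bigr => k _; rewrite hornerM hornerZ horner_euler_den subn_eq0 leqNgt.
rewrite ltn_ord /= addr0 (bin_factE (ltnW (ltn_ord k))) expr1n /euler.
by field; rewrite !fact_neq0.
Qed.

(** The recurrence is triangular with diagonal coefficient r + 1. *)
Lemma binom_rec_uniq r (a b : nat -> K) : r + 1 != 0 ->
  (forall n, r * binom_transform 1 a n + a n = r * binom_transform 1 b n + b n) ->
  a =1 b.
Proof.
move=> r1 eq_ab n; elim/ltn_ind: n => n IHn.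
have := eq_ab n; rewrite /binom_transform !big_ord_recr /= binn subnn.
under eq_bigr => k _ do rewrite IHn //.
move=> eq_n; apply: (mulfI r1); apply: (addrI (r * (\sum_(k < n)
  'C(n, k)%:R * b k * 1 ^+ (n - k)))).
by move: eq_n; rewrite !mulrDr expr0 !mulr1 !mul1r -!addrA !mulrDl !mul1r.
Qed.

(** Transforms by 1 and by z commute, so both sides solve the recurrence with right-hand side 2 (x +
    z)^n. *)
Lemma euler_addr r x z n : r + 1 != 0 ->
  euler n r (x + z) = binom_transform z (fun k => euler k r x) n.
Proof.
move=> r1; apply: (@binom_rec_uniq r (fun n => euler n r (x + z))) => // m.
rewrite euler_rec // binom_transform_comp [z + 1]addrC -binom_transform_comp.
rewrite -binom_transformZ -binom_transformD.
rewrite (eq_binom_transform z (fun k => euler_rec x k r1)).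
by rewrite binom_transformZ binom_transform_expr.
Qed.

Lemma binom_transform_scale c z (a : nat -> K) n :
  binom_transform (c * z) (fun k => c ^+ k * a k) n =
  c ^+ n * binom_transform z a n.
Proof.
rewrite /binom_transform mulr_sumr; apply: eq_bigr => k _.
have le_kn : (k <= n)%N by rewrite -ltnS.
by rewrite -[in c ^+ n](subnK le_kn) exprD exprMn; ring.
Qed.

(** With f i = (-1)^i r^i g i, the left side is the sum of f i - f (i+1). *)
Lemma alternating_telescope r (g : nat -> K) w :
  r * (\sum_(i < w) (-1) ^+ i * r ^+ i * g i.+1)
    + \sum_(i < w) (-1) ^+ i * r ^+ i * g i
  = g 0%N - (-1) ^+ w * r ^+ w * g w.
Proof.
elim: w => [|w IHw]; first by rewrite !big_ord0; ring.
rewrite !big_ord_recr /= mulrDr addrACA IHw !exprS; ring.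
Qed.

Lemma euler_distribution r x w n : odd w -> r + 1 != 0 -> r ^+ w + 1 != 0 ->
  w%:R ^+ n * (\sum_(i < w) (-1) ^+ i * r ^+ i * euler n (r ^+ w) (x + i%:R / w%:R))
  = euler n r (w%:R * x).
Proof.
move=> w_odd r1 rw1.
have w0 : w%:R != 0 :> K by case: w w_odd {rw1}.
apply: (@binom_rec_uniq r (fun n => w%:R ^+ n * _)
                          (fun n => euler n r (w%:R * x))) => // m.
(* Writing the shift 1 as w * (1/w) lets the factor w^k pass through the transform, leaving a shift
   by 1/w that moves node i to node i + 1. *)
rewrite euler_rec // -{1}(mulfV w0) binom_transform_scale binom_transform_sum.
pose g i := euler m (r ^+ w) (x + i%:R / w%:R).
have gS i : binom_transform w%:R^-1
    (fun k => euler k (r ^+ w) (x + i%:R / w%:R)) m = g i.+1.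
  by rewrite -euler_addr // /g -natr1 mulrDl mul1r addrA.
under eq_bigr => i _ do rewrite binom_transformZ gS.
rewrite mulrCA -mulrDr -[X in _ * (_ + X)]/(\sum_(i < w) _ * g i).
(* As w is odd, the boundary terms are g 0 + r^w g w; since g w is g 0 shifted by 1, [euler_rec] for
   [r ^+ w] evaluates them. *)
rewrite alternating_telescope -signr_odd w_odd expr1 mulN1r mulNr opprK addrC.
rewrite /g mulfV // euler_addr // mul0r addr0 euler_rec // exprMn; ring.
Qed.

(** Expand each value by [euler_addr] and sum over i first. The numerator c is kept general: it is
    taken to be w1 for the fourth expression and 1 for the trinomial one. *)
Lemma euler_power_sum r s x c w n : (0 < w)%N -> r + 1 != 0 ->
  w%:R ^+ n * (\sum_(i < w) (-1) ^+ i * s ^+ i * euler n r (x + c / w%:R * i%:R))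
  = \sum_(k < n.+1) 'C(n, k)%:R * euler k r x * alt_power_sum (n - k) s (w - 1)
      * c ^+ (n - k) * w%:R ^+ k.
Proof.
move=> w_gt0 r1.
have w0 : w%:R != 0 :> K by rewrite -(prednK w_gt0) char0.
rewrite /alt_power_sum subn1 prednK //.
under eq_bigr => i _ do rewrite euler_addr // mulr_sumr.
rewrite exchange_big mulr_sumr; apply: eq_bigr => k _ /=.
rewrite mulr_sumr -!mulrA !(mulr_suml, mulr_sumr); apply: eq_bigr => i _.
have le_kn : (k <= n)%N by rewrite -ltnS.
rewrite -[in w%:R ^+ n](subnK le_kn) exprD !exprMn exprVn.
by field; rewrite expf_neq0.
Qed.

(** * Reduction of the other expressions to the first *)

Section Symmetry.
Variables (q y : K) (w1 w2 n : nat).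
Hypotheses (w1_odd : odd w1) (w2_odd : odd w2).
Hypotheses (q1 : q ^+ w1 + 1 != 0) (q2 : q ^+ w2 + 1 != 0).
Hypothesis q12 : q ^+ (w1 * w2) + 1 != 0.
Let W1 : K := w1%:R.
Let W2 : K := w2%:R.

Definition euler_power_sum_mix : K :=
  \sum_(k < n.+1) 'C(n, k)%:R * euler k (q ^+ w2) (W1 * y)
    * alt_power_sum (n - k) (q ^+ w1) (w2 - 1) * W1 ^+ (n - k) * W2 ^+ k.

Lemma euler_power_sum_mixE :
  W2 ^+ n * (\sum_(i < w2) (-1) ^+ i * q ^+ (w1 * i)
      * euler n (q ^+ w2) (W1 * y + W1 / W2 * i%:R)) = euler_power_sum_mix.
Proof.
rewrite /euler_power_sum_mix -euler_power_sum ?odd_gt0 //.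
by congr (_ * _); apply: eq_bigr => i _; rewrite exprM.
Qed.

Let distribution k x :
  W1 ^+ k * (\sum_(i < w1) (-1) ^+ i * q ^+ (w2 * i)
      * euler k (q ^+ (w1 * w2)) (x + i%:R / W1)) = euler k (q ^+ w2) (W1 * x).
Proof.
rewrite -euler_distribution // -?exprM 1?mulnC //.
by congr (_ * _); apply: eq_bigr => i _; rewrite exprM.
Qed.

Lemma euler_power_sum_mix_distribution :
  W1 ^+ n * (\sum_(k < n.+1) 'C(n, k)%:R
      * alt_power_sum (n - k) (q ^+ w1) (w2 - 1) * W2 ^+ k
      * \sum_(i < w1) (-1) ^+ i * q ^+ (w2 * i)
          * euler k (q ^+ (w1 * w2)) (y + i%:R / W1)) = euler_power_sum_mix.
Proof.
rewrite mulr_sumr; apply: eq_bigr => k _; rewrite -distribution.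
have le_kn : (k <= n)%N by rewrite -ltnS.
by rewrite -[in W1 ^+ n](subnK le_kn) exprD; ring.
Qed.

(** In the fourth expression, each term indexed by j is split by the distribution relation at y +
    j/w2. *)
Lemma euler_power_sum_mix_double :
  (W1 * W2) ^+ n * (\sum_(i < w1) \sum_(j < w2)
      (-1) ^+ (i + j) * q ^+ (w2 * i + w1 * j)
      * euler n (q ^+ (w1 * w2)) (y + i%:R / W1 + j%:R / W2))
  = euler_power_sum_mix.
Proof.
rewrite -euler_power_sum_mixE exchange_big [W1 * W2]mulrC exprMn -mulrA.
congr (_ * _); rewrite mulr_sumr; apply: eq_bigr => j _.
have -> : W1 * y + W1 / W2 * j%:R = W1 * (y + j%:R / W2) by ring.
rewrite -distribution !mulr_sumr; apply: eq_bigr => i _.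
by rewrite addrAC !exprD; ring.
Qed.

(** The distribution relation turns [euler s] at w1 y into a sum over i, which [euler_power_sum]
    expands; the coefficients combine as C(n,s) C(s,k) = n! / (k! (s-k)! (n-s)!). *)
Lemma euler_power_sum_mix_trinomial :
  \sum_(k < n.+1) \sum_(l < n.+1) \sum_(m < n.+1 | (k + l + m)%N == n)
      trinomial K n k l m * euler k (q ^+ (w1 * w2)) y
      * alt_power_sum l (q ^+ w2) (w1 - 1) * alt_power_sum m (q ^+ w1) (w2 - 1)
      * W1 ^+ (k + m) * W2 ^+ (k + l) = euler_power_sum_mix.
Proof.
rewrite (big_ord_trinomial n (fun k l m => trinomial K n k l m *
  euler k (q ^+ (w1 * w2)) y * alt_power_sum l (q ^+ w2) (w1 - 1) *
  alt_power_sum m (q ^+ w1) (w2 - 1) * W1 ^+ (k + m) * W2 ^+ (k + l))).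
apply: eq_bigr => s _; rewrite -distribution.
have le_sn : (s <= n)%N by rewrite -ltnS.
have := @euler_power_sum (q ^+ (w1 * w2)) (q ^+ w2) y 1 w1 s (odd_gt0 w1_odd) q12.
under eq_bigr => i _ do rewrite -exprM div1r [_^-1 * _]mulrC.
move=> ->; move: (alt_power_sum (n - s) _ _) => T.
rewrite mulr_sumr !mulr_suml; apply: eq_bigr => k _.
have le_ks : (k <= s)%N by rewrite -ltnS.
rewrite subnKC // exprD expr1n !bin_factE // /trinomial !natrM.
by field; rewrite !fact_neq0.
Qed.

End Symmetry.
End EulerValues.

Theorem mainTheorem1 (R : realType) (p : nat) (p_prime : prime p)
    (p_odd : odd p) (C : padicComplex R p) (q : Cp C)
    (hq : absCp (q - 1) < p%:R `^ (- (p%:R - 1)^-1))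
    (w1 w2 : nat) (w1_odd : odd w1) (w2_odd : odd w2)
    (n : nat) (y1 : Qp C) (hy1 : padic_integer y1) :
  let W1 : Cp C := w1%:R in
  let W2 : Cp C := w2%:R in
  let y : Cp C := Qp_Cp y1 in
  let A1 : Cp C :=
    \sum_(k < n.+1) 'C(n, k)%:R * euler k (q ^+ w2) (W1 * y)
      * alt_power_sum (n - k) (q ^+ w1) (w2 - 1) * W1 ^+ (n - k) * W2 ^+ k in
  let A2 : Cp C :=
    \sum_(k < n.+1) 'C(n, k)%:R * euler k (q ^+ w1) (W2 * y)
      * alt_power_sum (n - k) (q ^+ w2) (w1 - 1) * W2 ^+ (n - k) * W1 ^+ k in
  let A3 : Cp C :=
    W1 ^+ n * \sum_(i < w1) (-1) ^+ i * q ^+ (w2 * i)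
      * euler n (q ^+ w1) (W2 * y + W2 / W1 * i%:R) in
  let A4 : Cp C :=
    W2 ^+ n * \sum_(i < w2) (-1) ^+ i * q ^+ (w1 * i)
      * euler n (q ^+ w2) (W1 * y + W1 / W2 * i%:R) in
  let A5 : Cp C :=
    \sum_(k < n.+1) \sum_(l < n.+1) \sum_(m < n.+1 | (k + l + m)%N == n)
      trinomial (Cp C) n k l m * euler k (q ^+ (w1 * w2)) y
      * alt_power_sum l (q ^+ w2) (w1 - 1) * alt_power_sum m (q ^+ w1) (w2 - 1)
      * W1 ^+ (k + m) * W2 ^+ (k + l) in
  let A6 : Cp C :=
    W1 ^+ n * \sum_(k < n.+1) 'C(n, k)%:R
      * alt_power_sum (n - k) (q ^+ w1) (w2 - 1) * W2 ^+ k
      * \sum_(i < w1) (-1) ^+ i * q ^+ (w2 * i)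
          * euler k (q ^+ (w1 * w2)) (y + i%:R / W1) in
  let A7 : Cp C :=
    W2 ^+ n * \sum_(k < n.+1) 'C(n, k)%:R
      * alt_power_sum (n - k) (q ^+ w2) (w1 - 1) * W1 ^+ k
      * \sum_(i < w2) (-1) ^+ i * q ^+ (w1 * i)
          * euler k (q ^+ (w1 * w2)) (y + i%:R / W2) in
  let A8 : Cp C :=
    (W1 * W2) ^+ n * \sum_(i < w1) \sum_(j < w2)
      (-1) ^+ (i + j) * q ^+ (w2 * i + w1 * j)
      * euler n (q ^+ (w1 * w2)) (y + i%:R / W1 + j%:R / W2) in
  A1 = A2 /\ A2 = A3 /\ A3 = A4 /\ A4 = A5 /\ A5 = A6 /\ A6 = A7 /\ A7 = A8.
Proof.
move=> W1 W2 y A1 A2 A3 A4 A5 A6 A7 A8.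
have char0 := @Cp_char0 R p C.
have nz k : q ^+ k + 1 != 0 by apply: Cp_expr_add1_neq0.
have e41 : A4 = A1 by apply: euler_power_sum_mixE.
have e32 : A3 = A2 by apply: euler_power_sum_mixE.
have e61 : A6 = A1 by apply: euler_power_sum_mix_distribution.
have e72 : A7 = A2.
  by rewrite /A7 mulnC; apply: euler_power_sum_mix_distribution.
have e81 : A8 = A1 by apply: euler_power_sum_mix_double.
(* Exchanging the two sums shows that A8 is invariant under swapping w1 and w2, which links A1 to
   its mirror image A2. *)
have e82 : A8 = A2.
  rewrite -[RHS](@euler_power_sum_mix_double (Cp C)) // /A8 exchange_big.
  rewrite [W1 * W2]mulrC [(w1 * w2)%N]mulnC; congr (_ * _).
  apply: eq_bigr => j _; apply: eq_bigr => i _.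
  by rewrite addnC [(w2 * i + _)%N]addnC addrAC.
have e51 : A5 = A1 by apply: euler_power_sum_mix_trinomial.
by rewrite e51 e41 e32 e61 e72 -e82 e81.
Qed.
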